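(* Let $\phi_1:(0,\infty)\to(0,\infty)$ be a measurable function, $Z_1=V_2/V_1$, and let $\delta_{\phi_1}=V_1\phi_1(Z_1)$ be the corresponding estimator of $\sigma_1$. Let $\beta$ be the unique solution of $E\big(L'(\beta Z)\big)=0$, where $Z\sim \mathrm{Gamma}(b-a+1,1)$. Define $c(1,z_1)=\beta(1+z_1)$ and $\phi_1^*(z_1)=\min\{\phi_1(z_1),c(1,z_1)\}$. If $P_\eta\big(\phi_1(Z_1)>c(1,Z_1)\big)\neq 0$ for some $\eta>0$, then the estimator $\delta_{\phi_1^*}=V_1\phi_1^*(Z_1)$ of $\sigma_1$ has uniformly smaller risk than $\delta_{\phi_1}$ under the scale invariant loss $L$, that is, $R(\theta,\delta_{\phi_1^*})<R(\theta,\delta_{\phi_1})$ for all $\theta$.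
   Context: Fix integers $1\le a_i<b_i\le n_i$, $i=1,2$, and put $a=a_1+a_2$, $b=b_1+b_2$. The unknown parameter is $\theta=(\mu_1,\mu_2,\sigma_1,\sigma_2)$ with $\mu_1,\mu_2\in\mathbb{R}$ and $0<\sigma_1\le\sigma_2$; $\eta=\sigma_1/\sigma_2\in(0,1]$. From a random sample of size $n_i$ from the exponential distribution with density $\sigma_i^{-1}e^{-(x-\mu_i)/\sigma_i}$, $x>\mu_i$, one observes only the order statistics of ranks $a_i,\dots,b_i$ (doubly type-II censored sample). A complete sufficient statistic is $(X_{a_1},X_{a_2},V_1,V_2)$, consisting of four independent random variables, where $X_{a_i}$ has density $$\frac{n_i!}{(a_i-1)!(n_i-a_i)!}\Big[1-e^{-\frac{x-\mu_i}{\sigma_i}}\Big]^{a_i-1}\frac1{\sigma_i}\Big[e^{-\frac{x-\mu_i}{\sigma_i}}\Big]^{n_i-a_i+1},\quad x>\mu_i,$$ and $V_i$ has the gamma distribution with shape $b_i-a_i$ and scale $\sigma_i$. $\mathrm{Gamma}(k,1)$ denotes the gamma distribution with shape $k$ and scale $1$. The loss for estimating $\sigma_1$ by $\delta$ is $L(\delta/\sigma_1)$, where $L$ is differentiable and: (i) $L(t)$ is bowl-shaped with minimum value $0$ attained at $t=1$, decreasing for $t\le1$ and increasing for $t\ge1$; (ii) all integrals involving $L$ are finite and differentiation under the integral sign is permissible. The risk is $R(\theta,\delta)=E_\theta L(\delta/\sigma_1)$. The law of $Z_1=V_2/V_1$ depends on $\theta$ only through $\eta$; $P_\eta$ denotes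 probability under $\eta$. *)

(* Defs.v *)
From HB Require Import structures.
From mathcomp Require Import all_boot all_order all_algebra.
From mathcomp Require Import all_classical all_reals all_analysis.
Set Implicit Arguments.
Unset Strict Implicit.
Unset Printing Implicit Defensive.
Import Order.TTheory GRing.Theory Num.Theory.
Import numFieldNormedType.Exports.
Local Open Scope classical_set_scope.
Local Open Scope ring_scope.

Record param (R : realType) := Param {
  mu1 : R;
  mu2 : R;
  sigma1 : R;
  sigma2 : R;
  sigma1_gt0 : 0 < sigma1;
  sigma1_le2 : sigma1 <= sigma2 }.

Definition scale_ratio (R : realType) (theta : param R) : R :=
  sigma1 theta / sigma2 theta.

(* Density of the a-th order statistic (a >= 1) of a sample of size n from the
   exponential distribution with location mu and scale sigma. *)
Definition order_stat_pdf (R : realType) (a n : nat) (mu sigma x : R) : R :=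
  if mu < x then
    n`!%:R / ((a.-1)`!%:R * (n - a)`!%:R)
    * (1 - expR (- ((x - mu) / sigma))) ^+ a.-1
    * sigma^-1 * expR (- ((x - mu) / sigma)) ^+ (n - a).+1
  else 0.

(* Gamma distribution with scale sigma and integer shape k >= 1, for which
   the Gamma function at k is (k - 1)!. *)
Definition gamma_pdf (R : realType) (k : nat) (sigma x : R) : R :=
  if 0 < x then
    x ^+ k.-1 * expR (- (x / sigma)) / ((k.-1)`!%:R * sigma ^+ k)
  else 0.

Definition has_density d (T : measurableType d) (R : realType)
    (P : probability T R) (X : {mfun T >-> R}) (f : R -> R) : Prop :=
  forall A : set R, measurable A ->
    distribution P X A = (\int[lebesgue_measure]_(x in A) (f x)%:E)%E.

(* E (g Y) for Y ~ Gamma(k, 1). Only the values of g on (0, +oo) matter. As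
   everywhere in the library, the integral takes a junk value when the
   integrand is not integrable; see [loss_regular]. *)
Definition gamma_mean (R : realType) (k : nat) (g : R -> R) : R :=
  \int[lebesgue_measure]_(y in `]0, +oo[) (g y * gamma_pdf k 1 y).

Definition gamma_integrable (R : realType) (k : nat) (g : R -> R) : Prop :=
  lebesgue_measure.-integrable (`]0, +oo[ : set R)
    (fun y => (g y * gamma_pdf k 1 y)%:E).

(* The four statistics live on one measurable space and P theta is the
   probability under the parameter theta. V1 and V2 are (0, +oo)-valued, so
   that functions of V2 / V1 defined on (0, +oo) only make sense. *)
Record censored_model d (Omega : measurableType d) (R : realType)
    (a1 b1 n1 a2 b2 n2 : nat) (P : param R -> probability Omega R)
    (Xa1 Xa2 V1 V2 : {mfun Omega >-> R}) : Prop := CensoredModel {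
  V1_gt0 : forall w, 0 < V1 w;
  V2_gt0 : forall w, 0 < V2 w;
  law_Xa1 : forall theta, has_density (P theta) Xa1
    (order_stat_pdf a1 n1 (mu1 theta) (sigma1 theta));
  law_Xa2 : forall theta, has_density (P theta) Xa2
    (order_stat_pdf a2 n2 (mu2 theta) (sigma2 theta));
  law_V1 : forall theta, has_density (P theta) V1
    (gamma_pdf (b1 - a1) (sigma1 theta));
  law_V2 : forall theta, has_density (P theta) V2
    (gamma_pdf (b2 - a2) (sigma2 theta));
  (* Taking some of the sets equal to setT gives the product rule for every
     subfamily. *)
  independent_stats : forall theta (A1 A2 A3 A4 : set R),
    measurable A1 -> measurable A2 -> measurable A3 -> measurable A4 ->
    P theta (Xa1 @^-1` A1 `&` Xa2 @^-1` A2 `&` V1 @^-1` A3 `&` V2 @^-1` A4)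
    = (P theta (Xa1 @^-1` A1) * P theta (Xa2 @^-1` A2)
       * P theta (V1 @^-1` A3) * P theta (V2 @^-1` A4))%E }.

(* The loss is a function on (0, +oo); its values elsewhere are irrelevant.
   Monotonicity is meant in the weak sense. *)
Record bowl_shaped_loss (R : realType) (L : R -> R) : Prop := BowlShapedLoss {
  loss_derivable : forall t : R, 0 < t -> derivable L t 1;
  loss_at1 : L 1 = 0;
  loss_decreasing : {in `]0, 1] &, {homo L : s t /~ s <= t}};
  loss_increasing : {in `[1, +oo[ &, {homo L : s t / s <= t}} }.

(* For Y ~ Gamma(k, 1), c |-> E (L (c Y)) is finite on (0, +oo) and can be
   differentiated under the integral sign. *)
Record loss_regular (R : realType) (k : nat) (L : R -> R) : Prop :=
  LossRegular {
  loss_integrable : forall c : R, 0 < c ->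
    gamma_integrable k (fun y => L (c * y));
  dloss_integrable : forall c : R, 0 < c ->
    gamma_integrable k (fun y => y * derive1 L (c * y));
  loss_derive_mean : forall c : R, 0 < c ->
    is_derive c (1 : R) (fun u : R => gamma_mean k (fun y => L (u * y)))
      (gamma_mean k (fun y => y * derive1 L (c * y))) }.

Definition scale_estimator d (Omega : measurableType d) (R : realType)
    (V1 V2 : Omega -> R) (phi : R -> R) : Omega -> R :=
  fun w => V1 w * phi (V2 w / V1 w).

Definition risk d (Omega : measurableType d) (R : realType)
    (P : param R -> probability Omega R) (L : R -> R)
    (theta : param R) (delta : Omega -> R) : \bar R :=
  ('E_(P theta)[fun w => L (delta w / sigma1 theta)%R])%E.

(* Main.v *)
(* Given V2 / V1 = z, V1 / sigma1 is 1 / (1 + eta z) times a Gamma(k, 1)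
   variable, k = b - a, so the conditional risk of V1 phi (V2 / V1) is
   g (phi z / (1 + eta z)) with g c = E (L (c Y)), Y ~ Gamma(k, 1).
   Since g' c = k E (L' (c Z)) with Z ~ Gamma(k + 1, 1), beta is the only
   critical point of g; the monotone likelihood ratio of the gamma scale family
   and the bowl shape of L give g' >= 0 on [beta, +oo), so that g increases
   strictly there. As eta <= 1, replacing phi z > beta (1 + z) by beta (1 + z)
   keeps the argument of g in [beta, +oo) and decreases it. The set where this
   happens has positive Lebesgue measure, and V2 / V1 has a positive density
   under every theta, hence the strict inequality for all theta. *)
Require Import Defs.
From HB Require Import structures.
From mathcomp Require Import all_boot all_order all_algebra.
From mathcomp Require Import all_classical all_reals all_analysis.
From mathcomp Require Import measurable_realfun.
From mathcomp Require Import ring.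
Set Implicit Arguments.
Unset Strict Implicit.
Unset Printing Implicit Defensive.
Import Order.TTheory GRing.Theory Num.Theory.
Import numFieldNormedType.Exports.
Local Open Scope classical_set_scope.
Local Open Scope ring_scope.

(** * Rescaling in Lebesgue integrals *)

(** Uniqueness of Lebesgue measure: c times the pushforward gives each half-open interval its
    length, since the preimage of ]a, b] is ]a / c, b / c]. *)
Lemma lebesgue_measure_scale (R : realType) (c : R) (A : set R) :
  0 < c -> measurable A ->
  pushforward lebesgue_measure ( *%R c : _ -> measurableTypeR R) A
  = (c^-1%:E * lebesgue_measure A)%E.
Proof.
move=> c0 mA.
have mc : measurable_fun [set: R] ( *%R c : R -> measurableTypeR R).
  exact: measurable_funM.
pose nu := mscale (NngNum (ltW c0))
  (measure_function_pushforward__canonical__measure_function_Measure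
     (@lebesgue_measure R) mc).
suff -> : lebesgue_measure A = nu A.
  by rewrite /nu /mscale /= muleA -EFinM mulVf ?mul1e// gt_eqF.
apply: lebesgue_measure_unique => // _ [[a b]] _ <- /=.
have cE : ( *%R c : R -> R) @^-1` `]a, b]%classic = `]a / c, b / c]%classic.
  apply/seteqP; split => x /=; rewrite !in_itv/=.
    by rewrite ltr_pdivrMr// ler_pdivlMr// ![x * c]mulrC.
  by rewrite ltr_pdivrMr// ler_pdivlMr// ![x * c]mulrC.
transitivity (c%:E * @lebesgue_measure R `](a / c)%R, (b / c)%R]%classic)%E; last first.
  by rewrite -cE.
rewrite !lebesgue_measure_itv/= !lte_fin ltr_pM2r ?invr_gt0//.
case: ifPn => _; last by rewrite mule0.
by rewrite -!EFinD -EFinM -mulrBl mulrCA divff ?mulr1// gt_eqF.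
Qed.

Lemma ge0_integral_lebesgue_scale (R : realType) (c : R) (f : R -> \bar R) :
  0 < c -> measurable_fun [set: R] f -> (forall x, 0 <= f x)%E ->
  (\int[lebesgue_measure]_x f x
   = c%:E * \int[lebesgue_measure]_x f (c * x)%R)%E.
Proof.
move=> c0 mf f0.
have mc : measurable_fun [set: R] ( *%R c : R -> measurableTypeR R).
  exact: measurable_funM.
have := @ge0_integral_pushforward _ _ (measurableTypeR R) (measurableTypeR R) R _ mc lebesgue_measure setT f
  measurableT mf (fun y _ => f0 y).
rewrite preimage_setT => /= <-.
have cV0 : 0 <= c^-1 by rewrite invr_ge0 ltW.
have -> : (\int[pushforward lebesgue_measure
      ( *%R c : _ -> measurableTypeR R)]_x f x
    = \int[mscale (NngNum cV0) lebesgue_measure]_x f x)%E.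
  by apply: eq_measure_integral => A mA _; rewrite /= lebesgue_measure_scale.
by rewrite ge0_integral_mscale//= muleA -EFinM divff ?mul1e// gt_eqF.
Qed.

(** * Expectations from densities, and the ratio of independent variables *)

(** The law of X is absolutely continuous, and its Radon-Nikodym derivative equals f almost
    everywhere because both have the same integral over every measurable set. *)
Lemma ge0_integral_has_density d (T : measurableType d) (R : realType)
    (P : probability T R) (X : {mfun T >-> R}) (f : R -> R) (h : R -> \bar R) :
  has_density P X f -> measurable_fun [set: R] f -> (forall x, 0 <= f x) ->
  measurable_fun [set: R] h -> (forall x, 0 <= h x)%E ->
  (\int[P]_w h (X w) = \int[lebesgue_measure]_x (h x * (f x)%:E))%E.
Proof.
move=> Xf mf f0 mh h0.
have mX : measurable_fun [set: T] (X : T -> measurableTypeR R).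
  move=> mT A mA; exact: (@measurable_funPT _ _ _ _ X mT A).
(* [X'] is X with its target seen as [measurableTypeR R], so that its law and Lebesgue measure live
   on the same type. *)
pose X' : {mfun T >-> measurableTypeR R} :=
  HB.pack (X : T -> measurableTypeR R) (isMeasurableFun.Build _ _ _ _ _ mX).
pose nu := distribution P X'.
have nuE A : measurable A -> nu A = (\int[lebesgue_measure]_(x in A) (f x)%:E)%E.
  exact: Xf.
have mfE : measurable_fun [set: R] (EFin \o f) by exact/measurable_EFinP.
have domX : nu `<< (@lebesgue_measure R).
  apply/null_content_dominatesP => A mA A0; rewrite nuE//.
  rewrite (_ : (\int[_]_(x in A) _)%E =
               (\int[lebesgue_measure]_(x in A) `|(f x)%:E|)%E); last first.
    by apply: eq_integral => x _; rewrite gee0_abs// lee_fin.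
  by rewrite integral_abs_eq0//; exact: measurable_funTS.
rewrite -[LHS](@ge0_integral_distribution _ _ _ _ _ P X' h)//.
rewrite -(Radon_Nikodym_SigmaFinite.change_of_variables domX)//.
apply: ge0_ae_eq_integral => //.
- apply: emeasurable_funM => //.
  exact: measurable_int (Radon_Nikodym_SigmaFinite.f_integrable domX).
- exact: emeasurable_funM.
- by move=> x _; rewrite mule_ge0// Radon_Nikodym_SigmaFinite.f_ge0.
- by move=> x _; rewrite mule_ge0// lee_fin.
apply: ae_eqe_mul2l.
apply: integral_ae_eq => //.
  exact: Radon_Nikodym_SigmaFinite.f_integrable.
move=> A _ mA.
exact: etrans (esym (Radon_Nikodym_SigmaFinite.f_integral domX mA)) (nuE A mA).
Qed.

(** Inversion is continuous on the open set of nonzero reals; the point 0, where it takes a default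
    value, is split off. *)
Lemma measurable_invr (R : realType) :
  measurable_fun [set: R] (@GRing.inv R).
Proof.
have -> : [set: R] = [set 0] `|` [set~ 0] by rewrite setUv.
apply/measurable_funU => //; first exact: measurableC.
split; first exact: measurable_fun_set1.
apply: open_continuous_measurable_fun; first exact/closed_openC/closed_eq.
by move=> x /set_mem /eqP x0; exact: inv_continuous.
Qed.

(** By independence the joint law agrees with the product of the two laws on rectangles, hence
    everywhere; Tonelli then gives the iterated integral. *)
Lemma ge0_integral_indep_pair d (T : measurableType d) (R : realType)
    (P : probability T R) (X Y : {mfun T >-> R}) (f g : R -> R)
    (H : R * R -> \bar R) :
  has_density P X f -> has_density P Y g ->
  (forall A B, measurable A -> measurable B ->
     P (X @^-1` A `&` Y @^-1` B) = (P (X @^-1` A) * P (Y @^-1` B))%E) ->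
  measurable_fun [set: R] f -> (forall x, 0 <= f x) ->
  measurable_fun [set: R] g -> (forall x, 0 <= g x) ->
  measurable_fun [set: R * R] H -> (forall u, 0 <= H u)%E ->
  (\int[P]_w H (X w, Y w) = \int[lebesgue_measure]_x
     ((\int[lebesgue_measure]_y (H (x, y) * (g y)%:E)) * (f x)%:E))%E.
Proof.
move=> Xf Yg indep mf f0 mg g0 mH H0.
have mXY : measurable_fun [set: T] (fun w => (X w, Y w)).
  exact: measurable_fun_pair.
pose XY : {mfun T >-> (R * R)%type} :=
  HB.pack (fun w => (X w, Y w)) (isMeasurableFun.Build _ _ _ _ _ mXY).
pose F := fubini_F (distribution P Y) H.
have mF : measurable_fun [set: R] F.
  exact: measurable_fun_fubini_tonelli_F.
have F0 x : (0 <= F x)%E by exact: integral_ge0.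
transitivity (\int[distribution P XY]_u H u)%E.
  by rewrite ge0_integral_distribution.
transitivity (\int[(distribution P X \x distribution P Y)%E]_u H u)%E.
  apply: eq_measure_integral => A mA _; apply/esym.
  exact: product_measure_unique.
rewrite fubini_tonelli1// ge0_integral_distribution//.
rewrite (ge0_integral_has_density Xf mf f0 mF F0).
apply: eq_integral => x _; congr (_ * _)%E.
have mHx : measurable_fun [set: R] (fun y => H (x, y)).
  exact/measurableT_comp.
rewrite /F /fubini_F ge0_integral_distribution//.
by rewrite -(ge0_integral_has_density Yg mg g0 mHx).
Qed.

(** For fixed x > 0 the substitution y = x z has Jacobian x, so (X, Y / X) has density x f(x) g(x
    z). Tonelli then puts the integral over z outside. *)
Lemma ge0_integral_indep_ratio d (T : measurableType d) (R : realType)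
    (P : probability T R) (X Y : {mfun T >-> R}) (f g : R -> R)
    (K : R * R -> \bar R) :
  has_density P X f -> has_density P Y g ->
  (forall A B, measurable A -> measurable B ->
     P (X @^-1` A `&` Y @^-1` B) = (P (X @^-1` A) * P (Y @^-1` B))%E) ->
  measurable_fun [set: R] f -> (forall x, 0 <= f x) ->
  (forall x, x <= 0 -> f x = 0) ->
  measurable_fun [set: R] g -> (forall x, 0 <= g x) ->
  measurable_fun [set: R * R] K -> (forall u, 0 <= K u)%E ->
  (\int[P]_w K (X w, (Y w / X w)%R) = \int[lebesgue_measure]_z
     \int[lebesgue_measure]_x (K (x, z) * (x * f x * g (x * z)%R)%:E))%E.
Proof.
move=> Xf Yg indep mf f0 fN mg g0 mK K0.
pose H (u : R * R) := K (u.1, u.2 / u.1).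
have mH : measurable_fun [set: R * R] H.
  apply: measurableT_comp => //; apply: measurable_fun_pair => //.
  apply: measurable_funM => //.
  exact: measurableT_comp (@measurable_invr R) _.
rewrite (ge0_integral_indep_pair Xf Yg indep mf f0 mg g0 mH)//; last by move=> u; exact: K0.
pose G (u : R * R) := (K u * (u.1 * f u.1 * g (u.1 * u.2))%:E)%E.
have mG : measurable_fun [set: R * R] G.
  apply: emeasurable_funM => //; apply/measurable_EFinP.
  apply: measurable_funM; last first.
    by apply: (measurableT_comp mg); exact: measurable_funM.
  by apply: measurable_funM => //; exact: (measurableT_comp mf).
have G0 u : (0 <= G u)%E.
  apply: mule_ge0 => //; rewrite lee_fin mulr_ge0//.
  have [u0|u0] := leP u.1 0; first by rewrite fN// mulr0.
  by rewrite mulr_ge0// ltW.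
transitivity (\int[lebesgue_measure]_x \int[lebesgue_measure]_z G (x, z))%E;
  last exact: (@fubini_tonelli _ _ (measurableTypeR R) (measurableTypeR R) R
    lebesgue_measure lebesgue_measure G mG G0).
apply: eq_integral => x _.
(* For x <= 0 both sides vanish with f x, so the substitution is made for positive x only. *)
have [x0|x0] := leP x 0.
  rewrite fN// mule0 integral0_eq// => z _.
  by rewrite /G /= fN// mulr0 mul0r mule0.
have mHg : measurable_fun [set: R] (fun y => H (x, y) * (g y)%:E)%E.
  apply: emeasurable_funM; last exact/measurable_EFinP.
  exact: measurableT_comp mH (measurable_fun_pair _ _).
have Hg0 y : (0 <= H (x, y) * (g y)%:E)%E.
  by apply: mule_ge0; [exact: K0 | rewrite lee_fin].
rewrite (ge0_integral_lebesgue_scale x0)// muleC muleA -EFinM.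
rewrite -ge0_integralZl_EFin//; last 2 first.
- exact: (measurableT_comp mHg (measurable_funM _ _)).
- by rewrite mulr_ge0// ltW.
apply: eq_integral => z _.
rewrite /G /H /= [x * z]mulrC mulfK ?gt_eqF// muleCA -EFinM.
by rewrite [x * f x]mulrC.
Qed.

(** * Signs of a bowl-shaped loss and of its derivative *)

(** The difference quotients at x are nonnegative for either sign of h, once h is so small that h +
    x stays in the open interval. *)
Lemma nondecreasing_derive1_ge0 (R : realType) (f : R -> R) (a b x : R) :
  derivable f x 1 -> {in `]a, b[ &, {homo f : s t / s <= t}} ->
  x \in `]a, b[ -> 0 <= derive1 f x.
Proof.
move=> df ndf xab; rewrite derive1E; apply: limr_ge; first exact: df.
have nearab : \forall h \near (0 : R)^', h + x \in `]a, b[.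
  have : \forall h \near (0 : R), h + x \in `]a, b[.
    have : (h + x) @[h --> (0 : R)] --> x.
      rewrite -[X in _ --> X]add0r; apply: cvgD; [exact: cvg_id|exact: cvg_cst].
    by move=> hx; exact: (hx _ (near_in_itvoo xab)).
  by apply: filterS => h + _.
near=> h.
have hab : h + x \in `]a, b[ by near: h.
rewrite /= /GRing.scale /= mulr1.
have [h0|h0] := leP 0 h.
  by rewrite mulr_ge0 ?invr_ge0// subr_ge0 ndf// lerDr.
by rewrite mulr_le0// ?invr_le0 ?(ltW h0)// subr_le0 ndf// gerDr ltW.
Unshelve. all: by end_near. Qed.

Lemma nonincreasing_derive1_le0 (R : realType) (f : R -> R) (a b x : R) :
  derivable f x 1 -> {in `]a, b[ &, {homo f : s t /~ s <= t}} ->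
  x \in `]a, b[ -> derive1 f x <= 0.
Proof.
move=> df nif xab; rewrite -oppr_ge0 derive1E -deriveN// -derive1E.
apply: (@nondecreasing_derive1_ge0 _ _ a b) => //; first exact: derivableN.
by move=> s t sab tab st; rewrite lerN2 nif.
Qed.

Lemma bowl_loss_derive1_ge0 (R : realType) (L : R -> R) (t : R) :
  bowl_shaped_loss L -> 1 < t -> 0 <= derive1 L t.
Proof.
move=> [dL _ _ ndL] t1; apply: (@nondecreasing_derive1_ge0 _ _ 1 (t + 1)).
- exact: dL (lt_trans ltr01 t1).
- move=> u v; rewrite !in_itv/= => /andP[u1 _] /andP[v1 _]; apply: ndL;
    by rewrite in_itv/= andbT ltW.
- by rewrite in_itv/= t1 ltrDl ltr01.
Qed.

Lemma bowl_loss_derive1_le0 (R : realType) (L : R -> R) (t : R) :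
  bowl_shaped_loss L -> 0 < t < 1 -> derive1 L t <= 0.
Proof.
move=> [dL _ niL _] /andP[t0 t1]; apply: (@nonincreasing_derive1_le0 _ _ 0 1).
- exact: dL.
- move=> u v; rewrite !in_itv/= => /andP[u0 u1] /andP[v0 v1]; apply: niL;
    by rewrite in_itv/= ?u0 ?v0 ltW.
- by rewrite in_itv/= t0 t1.
Qed.

Lemma bowl_loss_ge0 (R : realType) (L : R -> R) (t : R) :
  bowl_shaped_loss L -> 0 < t -> 0 <= L t.
Proof.
move=> [_ L1 niL ndL] t0; rewrite -L1; have [t1|t1] := leP t 1.
  by apply: niL; rewrite ?in_itv/= ?ltr01 ?lexx ?t0 ?t1.
by apply: ndL; rewrite ?in_itv/= ?lexx// ?andbT ltW.
Qed.

(** * Gamma densities and gamma means *)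

Lemma gamma_pdf_ge0 (R : realType) (k : nat) (sigma x : R) :
  0 < sigma -> 0 <= gamma_pdf k sigma x.
Proof.
move=> s0; rewrite /gamma_pdf; case: ifPn => // x0.
by rewrite divr_ge0// mulr_ge0 ?expR_ge0// exprn_ge0// ltW.
Qed.

Lemma gamma_pdf_npos (R : realType) (k : nat) (sigma x : R) :
  x <= 0 -> gamma_pdf k sigma x = 0.
Proof. by rewrite /gamma_pdf ltNge => ->. Qed.

Lemma measurable_gamma_pdf (R : realType) (k : nat) (sigma : R) :
  measurable_fun [set: R] (gamma_pdf k sigma).
Proof.
apply: measurable_fun_ifT => //; first exact: measurable_fun_ltr.
apply: measurable_funM => //; apply: measurable_funM.
  exact: measurable_funX.
apply: (measurableT_comp (@measurable_expR R)).
by apply: measurableT_comp => //; exact: measurable_funM.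
Qed.

(** Size biasing: weighting Gamma(k, 1) by y, whose mean is k, gives Gamma(k + 1, 1). *)
Lemma gamma_pdfS (R : realType) (k : nat) (y : R) : (0 < k)%N ->
  gamma_pdf k.+1 1 y = k%:R^-1 * (y * gamma_pdf k 1 y).
Proof.
case: k => // k _; rewrite /gamma_pdf; case: ifPn => _; last by rewrite !mulr0.
rewrite /= !expr1n !mulr1 factS natrM invfM exprS.
by ring.
Qed.

(** The factor is, up to a constant, the likelihood ratio of two members of the scale family. It
    increases in x when r < 1. *)
Lemma gamma_pdf_scale (R : realType) (k : nat) (r x : R) : 0 < r -> 0 < x ->
  gamma_pdf k 1 (r * x)
  = r ^+ k.-1 * expR ((1 - r) * x) * gamma_pdf k 1 x.
Proof.
move=> r0 x0; rewrite /gamma_pdf x0 mulr_gt0// !divr1 exprMn.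
have -> : - (r * x) = (1 - r) * x + - x by ring.
by rewrite expRD; ring.
Qed.

(** The density vanishes off (0, +oo); integrals over the whole line fit the rescaling lemmas. *)
Lemma gamma_meanE (R : realType) (k : nat) (g : R -> R) :
  gamma_mean k g = \int[lebesgue_measure]_y (g y * gamma_pdf k 1 y).
Proof.
rewrite /gamma_mean Rintegral_mkcond; apply: eq_Rintegral => y _.
rewrite patchE; case: ifPn => //; rewrite notin_setE/= in_itv/= andbT.
by move=> /negP; rewrite -leNgt => y0; rewrite gamma_pdf_npos ?mulr0.
Qed.

Lemma gamma_integrableE (R : realType) (k : nat) (g : R -> R) :
  gamma_integrable k g <-> lebesgue_measure.-integrable [set: R]
    (fun y => (g y * gamma_pdf k 1 y)%:E).
Proof.
rewrite /gamma_integrable integrable_mkcond//.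
rewrite (_ : _ \_ _ = (fun y => (g y * gamma_pdf k 1 y)%:E))//.
apply/funext => y.
rewrite patchE; case: ifPn => //; rewrite notin_setE/= in_itv/= andbT.
by move=> /negP; rewrite -leNgt => y0; rewrite gamma_pdf_npos ?mulr0.
Qed.

(** * Strict increase of the mean loss beyond [beta] *)

Lemma integrable_lebesgue_scale (R : realType) (c : R) (f : R -> \bar R) :
  0 < c -> lebesgue_measure.-integrable [set: R] f ->
  lebesgue_measure.-integrable [set: R] (fun x => f (c * x)).
Proof.
move=> c0 /integrableP[mf foo]; apply/integrableP; split.
  by apply: (measurableT_comp mf); exact: measurable_funM.
move: foo; rewrite (ge0_integral_lebesgue_scale c0)//; last first.
  exact: measurableT_comp.
by case: (\int[lebesgue_measure]_x `|f (c * x)%R|)%E => [r _||//]; rewrite ?ltry// gt0_muley ?lte_fin.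
Qed.

(** The nonnegative case is applied to the positive and negative parts; integrability makes their
    difference well defined, so c can be factored out. *)
Lemma integral_lebesgue_scale (R : realType) (c : R) (f : R -> \bar R) :
  0 < c -> lebesgue_measure.-integrable [set: R] f ->
  (\int[lebesgue_measure]_x f x
   = c%:E * \int[lebesgue_measure]_x f (c * x)%R)%E.
Proof.
move=> c0 fi; have mf := measurable_int _ fi.
have fci := integrable_lebesgue_scale c0 fi.
have fp := ge0_integral_lebesgue_scale c0 (measurable_funepos mf).
have fn := ge0_integral_lebesgue_scale c0 (measurable_funeneg mf).
rewrite [LHS]integralE fp// fn//.
have := integrable_add_def measurableT fci.
rewrite (funepos_comp f ( *%R c)) (funeneg_comp f ( *%R c)) => fcdef.
by rewrite -muleBr//; congr (_ * _)%E; rewrite [RHS]integralE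
  (funepos_comp f ( *%R c)) (funeneg_comp f ( *%R c)).
Qed.

(* With r = beta / c, the substitution y -> r y turns the weight of L' (c y)
   into that of L' (beta y) times e^((1-r) y), which is larger than
   e^((1-r) / beta) exactly when L' (beta y) is nonnegative. *)
Lemma gamma_mean_dloss_ge0 (R : realType) (k : nat) (L : R -> R) (beta c : R) :
  bowl_shaped_loss L -> loss_regular k L -> (0 < k)%N -> 0 < beta ->
  gamma_mean k (fun y => y * derive1 L (beta * y)) = 0 -> beta < c ->
  0 <= gamma_mean k (fun y => y * derive1 L (c * y)).
Proof.
move=> L_bowl L_reg k0 beta0 F0 bc.
pose F u y := (y * derive1 L (u * y) * gamma_pdf k 1 y)%:E.
have c0 : 0 < c by exact: lt_trans bc.
have Fi u : 0 < u -> lebesgue_measure.-integrable [set: R] (F u).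
  by move=> u0; apply/gamma_integrableE; exact: dloss_integrable.
pose r := beta / c.
have r0 : 0 < r by rewrite divr_gt0.
have r1 : r < 1 by rewrite ltr_pdivrMr// mul1r.
(* One power of r comes from the factor y and k - 1 from the density; 1 / beta is the y at which
   beta y crosses 1, the minimum of L. *)
pose C := r ^+ k * expR ((1 - r) / beta).
have FE u : 0 < u ->
    (\int[lebesgue_measure]_y F u y)%E
    = (gamma_mean k (fun y => y * derive1 L (u * y)))%:E.
  move=> u0; rewrite gamma_meanE /Rintegral fineK//.
  exact: integrable_fin_num (Fi _ u0).
suff : (0 <= \int[lebesgue_measure]_y F c y)%E by rewrite FE.
rewrite (integral_lebesgue_scale r0 (Fi _ c0)).
apply: mule_ge0; first by rewrite lee_fin ltW.
(* The lower bound 0 is written as an integral, since [beta] is critical; it then suffices to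
   compare integrands pointwise. *)
have <- : (\int[lebesgue_measure]_y (C%:E * F beta y) = 0)%E.
  by rewrite integralZl ?FE ?F0 ?mule0//; exact: Fi.
apply: le_integral => //.
- exact/integrableZl/Fi.
- exact/integrable_lebesgue_scale/Fi.
move=> y _; rewrite /F -EFinM lee_fin.
have [y0|y0] := leP y 0.
  by rewrite !gamma_pdf_npos ?mulr0// pmulr_rle0.
have -> : C * (y * derive1 L (beta * y) * gamma_pdf k 1 y)
    = (r ^+ k * y * gamma_pdf k 1 y)
      * (derive1 L (beta * y) * expR ((1 - r) / beta)) by rewrite /C; ring.
have -> : r * y * derive1 L (c * (r * y)) * gamma_pdf k 1 (r * y)
    = (r ^+ k * y * gamma_pdf k 1 y)
      * (derive1 L (beta * y) * expR ((1 - r) * y)).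
  rewrite gamma_pdf_scale// (_ : c * (r * y) = beta * y); last first.
    by rewrite mulrA /r mulrC [c * _]mulrC divfK ?gt_eqF// mulrC.
  by rewrite -[in r ^+ k](prednK k0) exprS; ring.
apply: ler_wpM2l.
  by rewrite mulr_ge0 ?gamma_pdf_ge0// mulr_ge0 ?exprn_ge0// ltW.
have r1' : 0 < 1 - r by rewrite subr_gt0.
have [by1|by1|by1] := ltgtP (beta * y) 1.
- apply: ler_wnM2l; first by rewrite bowl_loss_derive1_le0// mulr_gt0.
  by rewrite ler_expR ler_pM2l// -div1r ler_pdivlMr// mulrC ltW.
- apply: ler_wpM2l; first exact: bowl_loss_derive1_ge0.
  by rewrite ler_expR ler_pM2l// -div1r ler_pdivrMr// mulrC ltW.
(* At y = 1 / beta the two exponentials coincide, whatever the derivative of L at 1. *)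
- by rewrite -[y](mulKf (lt0r_neq0 beta0)) by1 mulr1.
Qed.

(** Size biasing under the integral sign. It identifies the equation defining [beta], at shape k +
    1, with the vanishing of the derivative of the mean loss at shape k. *)
Lemma gamma_meanS (R : realType) (k : nat) (h : R -> R) : (0 < k)%N ->
  gamma_integrable k (fun y => y * h y) ->
  gamma_mean k.+1 h = k%:R^-1 * gamma_mean k (fun y => y * h y).
Proof.
move=> k0 /gamma_integrableE hi; rewrite !gamma_meanE -RintegralZl//.
by apply: eq_Rintegral => y _; rewrite gamma_pdfS//; ring.
Qed.

(** The derivative of the mean loss is nonnegative beyond [beta], and a zero there would be a second
    root of the equation for [beta]; so it is positive. *)
Lemma gamma_mean_loss_incr (R : realType) (k : nat) (L : R -> R) (beta : R) :
  bowl_shaped_loss L -> loss_regular k L -> (0 < k)%N ->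
  unique (fun u : R => 0 < u /\
    gamma_mean k.+1 (fun z => derive1 L (u * z)) = 0) beta ->
  forall s t, beta <= s -> s < t ->
  gamma_mean k (fun y => L (s * y)) < gamma_mean k (fun y => L (t * y)).
Proof.
move=> L_bowl L_reg k0 [[beta0 betaE] beta_uniq] s t bs st.
have crit (u : R) : 0 < u -> gamma_mean k.+1 (fun z => derive1 L (u * z))
    = k%:R^-1 * gamma_mean k (fun y => y * derive1 L (u * y)).
  by move=> u0; apply: gamma_meanS => //; exact: dloss_integrable.
have kV0 : k%:R^-1 != 0 :> R by rewrite invr_eq0 pnatr_eq0 -lt0n.
have D0 : gamma_mean k (fun y => y * derive1 L (beta * y)) = 0.
  by move: betaE; rewrite crit// => /eqP; rewrite mulf_eq0 (negPf kV0) => /eqP.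
pose g u := gamma_mean k (fun y => L (u * y)).
have dg (u : R) : 0 < u -> is_derive u 1 g
    (gamma_mean k (fun y => y * derive1 L (u * y))).
  exact: loss_derive_mean.
have gE (u : R) : 0 < u -> derive1 g u = gamma_mean k (fun y => y * derive1 L (u * y)).
  by move=> /dg[_ dgu]; rewrite derive1E.
have s0 : 0 < s by exact: lt_le_trans bs.
apply: (@gtr0_derive1_lt_cc _ g s t) => //.
- move=> u; rewrite in_itv/= => /andP[su _].
  by have [] := dg _ (lt_trans s0 su).
- move=> u; rewrite in_itv/= => /andP[su _].
  have bu : beta < u by exact: le_lt_trans su.
  have u0 := lt_trans beta0 bu.
  rewrite gE// lt_neqAle (gamma_mean_dloss_ge0 (beta := beta)) ?andbT//.
  apply/eqP => Du; have /beta_uniq ub : 0 < u /\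
      gamma_mean k.+1 (fun z => derive1 L (u * z)) = 0.
    by rewrite crit// -Du mulr0.
  by rewrite ub ltxx in bu.
- apply: derivable_within_continuous => u; rewrite in_itv/= => /andP[su _].
  by have [] := dg _ (lt_le_trans s0 su).
- by rewrite in_itv/= lexx ltW.
- by rewrite in_itv/= lexx ltW.
Qed.

(** * The ratio of two independent gamma variables *)

(* Density of Y / X on (0, +oo) for independent X ~ Gamma(m, s) and
   Y ~ Gamma(n, t): given Y / X = z, X is Gamma(m + n) of rate 1 / s + z / t. *)
Definition gamma_ratio_pdf (R : realType) (m n : nat) (s t z : R) : R :=
  z ^+ n.-1 * (m + n).-1`!%:R
  / ((s^-1 + z / t) ^+ (m + n) * (m.-1`!%:R * s ^+ m) * (n.-1`!%:R * t ^+ n)).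

Lemma gamma_ratio_pdf_gt0 (R : realType) (m n : nat) (s t z : R) :
  0 < s -> 0 < t -> 0 < z -> 0 < gamma_ratio_pdf m n s t z.
Proof.
move=> s0 t0 z0; have l0 : 0 < s^-1 + z / t by rewrite addr_gt0 ?divr_gt0 ?invr_gt0.
rewrite /gamma_ratio_pdf divr_gt0// !mulr_gt0 ?exprn_gt0//;
  by rewrite ltr0n fact_gt0.
Qed.

Lemma measurable_gamma_ratio_pdf (R : realType) (m n : nat) (s t : R) :
  measurable_fun [set: R] (gamma_ratio_pdf m n s t).
Proof.
apply: measurable_funM.
  by apply: measurable_funM => //; exact: measurable_funX.
apply: (measurableT_comp (@measurable_invr R)).
apply: measurable_funM => //; apply: measurable_funM => //.
apply: measurable_funX; apply: measurable_funD => //.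
exact: measurable_funM.
Qed.

(** At x = y / l the exponents x / s and x z / t add up to l x = y. The left side is the joint
    density of X and Y / X at (x, z). *)
Lemma gamma_ratio_kernel (R : realType) (m n : nat) (s t z y : R) :
  (0 < m)%N -> (0 < n)%N -> 0 < s -> 0 < t -> 0 < z ->
  let l := s^-1 + z / t in
  y / l * gamma_pdf m s (y / l) * gamma_pdf n t (y / l * z)
  = l * gamma_ratio_pdf m n s t z * gamma_pdf (m + n) 1 y.
Proof.
case: m n => [//|m] [//|n] _ _ s0 t0 z0 l.
have l0 : 0 < l by rewrite addr_gt0 ?divr_gt0 ?invr_gt0.
have [y0|y0] := leP y 0.
  have yl0 : y / l <= 0 by rewrite pmulr_lle0 ?invr_gt0.
  by rewrite !gamma_pdf_npos ?mulr0 ?mul0r// pmulr_lle0.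
have yl0 : 0 < y / l by rewrite divr_gt0.
rewrite /gamma_pdf y0 yl0 mulr_gt0// /gamma_ratio_pdf -/l !divr1 /=.
have -> : expR (- y) = expR (- (y / l / s)) * expR (- (y / l * z / t)).
  rewrite -expRD; congr expR; rewrite -opprD; congr (- _).
  have -> : y / l / s + y / l * z / t = y / l * l by rewrite /l; ring.
  by rewrite divfK// gt_eqF.
rewrite addSn addnS /= expr1n mulr1 !exprMn !exprVn !exprS !exprD.
have lN0 := lt0r_neq0 l0; have sN0 := lt0r_neq0 s0; have tN0 := lt0r_neq0 t0.
have factN0 k : k`!%:R != 0 :> R by rewrite pnatr_eq0 -lt0n fact_gt0.
move: (expf_neq0 m lN0) (expf_neq0 n lN0) (expf_neq0 m sN0) (expf_neq0 n tN0).
move: (factN0 m) (factN0 n) (factN0 (m + n).+1).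
(* Powers and factorials become opaque nonzero atoms, which leaves [field] a plain rational
   identity. *)
move: (l ^+ m) (l ^+ n) (s ^+ m) (t ^+ n) => lm ln sm tn.
move: (m`!%:R) (n`!%:R) ((m + n).+1`!%:R : R) => fm fn fmn.
clearbody l => *.
field.
do ?[apply/andP; split]; assumption.
Qed.

(** Disintegration along Y / X: the inner integral is the conditional expectation given Y / X = z.
    It comes from the substitution x = y / l, with l = 1 / s + z / t. *)
Lemma ge0_integral_gamma_ratio d (T : measurableType d) (R : realType)
    (P : probability T R) (X Y : {mfun T >-> R}) (m n : nat) (s t : R)
    (K : R * R -> \bar R) :
  (0 < m)%N -> (0 < n)%N -> 0 < s -> 0 < t ->
  has_density P X (gamma_pdf m s) -> has_density P Y (gamma_pdf n t) ->
  (forall A B, measurable A -> measurable B ->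
     P (X @^-1` A `&` Y @^-1` B) = (P (X @^-1` A) * P (Y @^-1` B))%E) ->
  measurable_fun [set: R * R] K -> (forall u, 0 <= K u)%E ->
  (\int[P]_w K (X w, (Y w / X w)%R) =
   \int[lebesgue_measure]_(z in `]0%R, +oo[) ((gamma_ratio_pdf m n s t z)%:E *
     \int[lebesgue_measure]_y (K ((y / (s^-1 + z / t))%R, z) *
                               (gamma_pdf (m + n) 1 y)%:E)))%E.
Proof.
move=> m0 n0 s0 t0 Xm Yn indep mK K0.
rewrite (ge0_integral_indep_ratio Xm Yn indep)//; last 5 first.
- exact: measurable_gamma_pdf.
- by move=> x; exact: gamma_pdf_ge0.
- by move=> x; exact: gamma_pdf_npos.
- exact: measurable_gamma_pdf.
- by move=> x; exact: gamma_pdf_ge0.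
rewrite [RHS]integral_mkcond; apply: eq_integral => z _; rewrite patchE.
(* For z <= 0, x and x z are never both positive, so one of the two densities vanishes. *)
have [z0|z0] := leP z 0.
  rewrite memNset ?integral0_eq//; last first.
    by rewrite /= in_itv/= andbT; apply/negP; rewrite -leNgt.
  move=> x _; have [x0|x0] := leP x 0.
    by rewrite (gamma_pdf_npos _ _ x0) mulr0 mul0r mule0.
  by rewrite [X in (_ * X)%R]gamma_pdf_npos ?mulr0 ?mule0// pmulr_rle0.
rewrite mem_set/=; last by rewrite in_itv/= z0.
have l0 : 0 < s^-1 + z / t by rewrite addr_gt0 ?divr_gt0 ?invr_gt0.
have mKz : measurable_fun [set: R] (fun x => K (x, z)).
  exact: measurableT_comp mK (measurable_fun_pair _ _).
rewrite (@ge0_integral_lebesgue_scale _ (s^-1 + z / t)^-1) ?invr_gt0//; last 2 first.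
- apply: emeasurable_funM => //; apply/measurable_EFinP.
  apply: measurable_funM.
    by apply: measurable_funM => //; exact: measurable_gamma_pdf.
  apply: (measurableT_comp (measurable_gamma_pdf n t)).
  exact: measurable_funM.
- move=> x; apply: mule_ge0 => //; rewrite lee_fin.
  have [x0|x0] := leP x 0; first by rewrite (gamma_pdf_npos _ _ x0) mulr0 mul0r.
  by rewrite !mulr_ge0 ?gamma_pdf_ge0// ltW.
transitivity ((s^-1 + z / t)^-1%:E * \int[lebesgue_measure]_y
    (((s^-1 + z / t) * gamma_ratio_pdf m n s t z)%:E *
     (K ((y / (s^-1 + z / t))%R, z) * (gamma_pdf (m + n) 1 y)%:E)))%E.
  congr (_ * _)%E; apply: eq_integral => y _.
  by rewrite [(_^-1 * y)%R]mulrC gamma_ratio_kernel// EFinM muleCA.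
rewrite ge0_integralZl_EFin//; last 3 first.
- by move=> y _; apply: mule_ge0 => //; rewrite lee_fin gamma_pdf_ge0.
- apply: emeasurable_funM.
    exact: (measurableT_comp mKz (measurable_funM _ _)).
  by apply/measurable_EFinP; exact: measurable_gamma_pdf.
- by rewrite mulr_ge0 ?ltW// gamma_ratio_pdf_gt0.
by rewrite muleA -EFinM mulKf// gt_eqF.
Qed.

(** * Strict comparison of integrals and measurability on the half-line *)

(** If the integrals were equal, being finite, g - f >= 0 would have integral 0 and vanish almost
    everywhere, against its positivity on the non-null set B. *)
Lemma ge0_integral_lt d (T : measurableType d) (R : realType)
    (mu : {measure set T -> \bar R}) (D B : set T) (f g : T -> R) :
  measurable D -> measurable B -> B `<=` D ->
  measurable_fun D f -> measurable_fun D g ->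
  (forall x, D x -> 0 <= f x <= g x) -> (forall x, B x -> f x < g x) ->
  mu B != 0%E -> (\int[mu]_(x in D) (g x)%:E < +oo)%E ->
  (\int[mu]_(x in D) (f x)%:E < \int[mu]_(x in D) (g x)%:E)%E.
Proof.
move=> mD mB BD mf mg fg fgB muB goo.
have gi : mu.-integrable D (EFin \o g).
  apply/integrableP; split; first exact/measurable_EFinP.
  apply: le_lt_trans goo; apply: ge0_le_integral => //.
  - by apply: measurableT_comp => //; exact/measurable_EFinP.
  - exact/measurable_EFinP.
  - move=> x Dx; rewrite lee_fin ger0_norm//.
    by have /andP[] := fg _ Dx; exact: le_trans.
have fi : mu.-integrable D (EFin \o f).
  apply: le_integrable gi => //; first exact/measurable_EFinP.
  move=> x Dx; rewrite lee_fin; have /andP[f0 fgx] := fg _ Dx.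
  by rewrite !ger0_norm// (le_trans f0).
rewrite lt_neqAle; apply/andP; split; last first.
  by apply: ge0_le_integral => //; (try exact/measurable_EFinP) => x Dx;
    rewrite lee_fin; have /andP[f0 fgx] := fg _ Dx; rewrite // (le_trans f0).
apply/eqP => fgE.
have dE : (\int[mu]_(x in D) `|(g x - f x)%:E| = 0)%E.
  transitivity (\int[mu]_(x in D) ((EFin \o g) x - (EFin \o f) x))%E.
    apply: eq_integral => x /set_mem Dx.
    by rewrite gee0_abs// lee_fin subr_ge0; have /andP[] := fg _ Dx.
  rewrite integralB//= fgE subee//; exact: integrable_fin_num gi.
have md : measurable_fun D (fun x => (g x - f x)%:E).
  by apply/measurable_EFinP; exact: measurable_funB.
have /(ae_eq_integral_abs mu mD md)[N [mN N0 DN]] := dE.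
move/negP : muB; apply; rewrite -measure_le0 -N0 le_measure ?inE//.
move=> x Bx; apply: DN => /= /(_ (BD _ Bx)) [] /eqP.
by rewrite subr_eq0 gt_eqF// fgB.
Qed.

Lemma measurable_restrict_pos (R : realType) (f : R -> R) :
  measurable_fun (`]0, +oo[ : set R) f ->
  measurable_fun [set: R] (fun x => if 0 < x then f x else 0).
Proof.
move=> mf; apply: measurable_fun_if => //; first exact: measurable_fun_ltr.
apply: measurable_funS mf => // x /= [_ x0].
by rewrite in_itv/= andbT.
Qed.

Lemma derivable_pos_measurable (R : realType) (f : R -> R) :
  (forall x, 0 < x -> derivable f x 1) ->
  measurable_fun (`]0, +oo[ : set R) f.
Proof.
move=> df; apply: open_continuous_measurable_fun; first exact: interval_open.
move=> x /set_mem/=; rewrite in_itv/= andbT => x0.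
by apply/differentiable_continuous/derivable1_diffP/df.
Qed.

(** Cutting L off at 0 changes nothing where the density is positive, and integrability makes the
    extended-real integral equal to the real-valued mean. *)
Lemma integral_loss_gamma (R : realType) (k : nat) (L : R -> R) (c : R) :
  loss_regular k L -> 0 < c ->
  (\int[lebesgue_measure]_y ((if (0 < c * y)%R then L (c * y)%R else 0%R)%:E
                             * (gamma_pdf k 1 y)%:E)
   = (gamma_mean k (fun y => L (c * y)))%:E)%E.
Proof.
move=> L_reg c0; rewrite gamma_meanE /Rintegral fineK; last first.
  by apply/integrable_fin_num/gamma_integrableE => //; exact: loss_integrable.
apply: eq_integral => y _; rewrite -EFinM.
have [y0|y0] := leP y 0; first by rewrite gamma_pdf_npos// !mulr0.
by rewrite mulr_gt0.
Qed.

(** * Law of V2 / V1 and integral formula for the risk *)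

Lemma independent_V1_V2 (R : realType) (a1 b1 n1 a2 b2 n2 : nat)
    (d : measure_display) (Omega : measurableType d)
    (P : param R -> probability Omega R) (Xa1 Xa2 V1 V2 : {mfun Omega >-> R})
    (theta : param R) :
  censored_model a1 b1 n1 a2 b2 n2 P Xa1 Xa2 V1 V2 ->
  forall A B : set R, measurable A -> measurable B ->
  P theta (V1 @^-1` A `&` V2 @^-1` B)
  = (P theta (V1 @^-1` A) * P theta (V2 @^-1` B))%E.
Proof.
move=> model A B mA mB.
have := independent_stats model theta measurableT measurableT mA mB.
by rewrite !preimage_setT !setTI !probability_setT !mul1e.
Qed.

(** Absolute continuity of the law of Y / X: disintegrating the indicator of B leaves an outer
    integral supported on the null set B. *)
Lemma gamma_ratio_null d (T : measurableType d) (R : realType)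
    (P : probability T R) (X Y : {mfun T >-> R}) (m n : nat) (s t : R)
    (B : set R) :
  (0 < m)%N -> (0 < n)%N -> 0 < s -> 0 < t ->
  has_density P X (gamma_pdf m s) -> has_density P Y (gamma_pdf n t) ->
  (forall A B, measurable A -> measurable B ->
     P (X @^-1` A `&` Y @^-1` B) = (P (X @^-1` A) * P (Y @^-1` B))%E) ->
  measurable B -> lebesgue_measure B = 0%E ->
  P [set w | B (Y w / X w)] = 0%E.
Proof.
move=> m0 n0 s0 t0 Xm Yn indep mB B0.
have mZ : measurable_fun [set: T] (fun w => Y w / X w).
  by apply: measurable_funM => //; exact: measurableT_comp (@measurable_invr R) _.
have mZB : measurable [set w | B (Y w / X w)].
  by rewrite -[X in measurable X]setTI; exact: mZ.
rewrite -[X in P X]setIT -integral_indic//.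
pose K (u : R * R) := (\1_B u.2 : R)%:E.
have mK : measurable_fun [set: R * R] K.
  by apply/measurable_EFinP; exact: measurableT_comp.
have K0 u : (0 <= K u)%E by rewrite lee_fin.
transitivity (\int[P]_w K (X w, (Y w / X w)%R))%E; first exact: eq_integral.
rewrite (ge0_integral_gamma_ratio m0 n0 s0 t0 Xm Yn indep mK K0).
pose c := (\int[lebesgue_measure]_y (gamma_pdf (m + n) (1 : R) y)%:E)%E.
pose F z := ((gamma_ratio_pdf m n s t z * \1_B z)%:E * c)%E.
have c0 : (0 <= c)%E.
  by apply: integral_ge0 => y _; rewrite lee_fin gamma_pdf_ge0.
rewrite (_ : integral _ _ _ = \int[lebesgue_measure]_(z in `]0%R, +oo[) F z)%E; last first.
  apply: eq_integral => z _; rewrite /F [(_ * \1_B z)%:E]EFinM -muleA; congr (_ * _)%E.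
  rewrite /c -ge0_integralZl_EFin//.
  - by move=> y _; rewrite lee_fin gamma_pdf_ge0.
  - by apply/measurable_EFinP; exact: measurable_gamma_pdf.
rewrite (@ge0_negligible_integral _ _ _ lebesgue_measure _ B)//; first last.
- move=> z /=; rewrite in_itv/= andbT => z0; apply: mule_ge0 => //.
  by rewrite lee_fin mulr_ge0// ltW// gamma_ratio_pdf_gt0.
- apply: emeasurable_funM => //; apply/measurable_EFinP.
  apply: measurable_funTS; apply: measurable_funM => //.
  exact: measurable_gamma_ratio_pdf.
apply: integral0_eq => z [_ nBz].
by rewrite /F indicE memNset// mulr0 mul0e.
Qed.

(** The weight in z does not involve [phi], so two estimators can be compared pointwise in z. *)
Lemma risk_scale_estimatorE (R : realType) (a1 b1 n1 a2 b2 n2 : nat)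
    (d : measure_display) (Omega : measurableType d)
    (P : param R -> probability Omega R) (Xa1 Xa2 V1 V2 : {mfun Omega >-> R})
    (L phi : R -> R) (theta : param R) :
  (a1 < b1)%N -> (a2 < b2)%N ->
  censored_model a1 b1 n1 a2 b2 n2 P Xa1 Xa2 V1 V2 ->
  bowl_shaped_loss L -> loss_regular (b1 - a1 + (b2 - a2)) L ->
  measurable_fun (`]0, +oo[ : set R) phi -> (forall z, 0 < z -> 0 < phi z) ->
  (risk P L theta (scale_estimator V1 V2 phi)
   = \int[lebesgue_measure]_(z in `]0%R, +oo[)
      (gamma_ratio_pdf (b1 - a1) (b2 - a2) (sigma1 theta) (sigma2 theta) z
       * gamma_mean (b1 - a1 + (b2 - a2))
           (fun y => L (phi z / (1 + scale_ratio theta * z) * y)))%:E)%E.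
Proof.
move=> ab1 ab2 model L_bowl L_reg mphi phi0.
set s := sigma1 theta; set t := sigma2 theta.
have s0 : 0 < s := sigma1_gt0 theta.
have t0 : 0 < t := lt_le_trans s0 (sigma1_le2 theta).
(* L and [phi] are controlled on (0, +oo) only; extending them by 0 makes K measurable and
   nonnegative everywhere. *)
pose L0 x := if 0 < x then L x else 0.
pose phi' z := if 0 < z then phi z else 0.
have mL0 : measurable_fun [set: R] L0.
  by apply: measurable_restrict_pos; apply: derivable_pos_measurable;
    exact: loss_derivable.
have mphi' : measurable_fun [set: R] phi' by exact: measurable_restrict_pos.
pose K (u : R * R) := (L0 (u.1 * phi' u.2 / s))%:E.
have mK : measurable_fun [set: R * R] K.
  apply/measurable_EFinP; apply: (measurableT_comp mL0).
  apply: measurable_funM => //; apply: measurable_funM => //.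
  exact: measurableT_comp.
have K0 u : (0 <= K u)%E.
  rewrite lee_fin /L0; case: ifPn => // ?; exact: bowl_loss_ge0.
have m0 : (0 < b1 - a1)%N by rewrite subn_gt0.
have n0 : (0 < b2 - a2)%N by rewrite subn_gt0.
transitivity (\int[P theta]_w K (V1 w, (V2 w / V1 w)%R))%E.
  rewrite /risk unlock; apply: eq_integral => w _.
  have z0 : 0 < V2 w / V1 w.
    by rewrite divr_gt0 ?(V1_gt0 model) ?(V2_gt0 model).
  rewrite /K /L0 /phi' /= z0 /scale_estimator ifT// divr_gt0// mulr_gt0//.
    exact: V1_gt0 model w.
  exact: phi0.
rewrite (ge0_integral_gamma_ratio m0 n0 s0 t0
  (law_V1 model theta) (law_V2 model theta) (independent_V1_V2 theta model) mK K0).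
apply: eq_integral => z /set_mem/=; rewrite in_itv/= andbT => z0.
rewrite [RHS]EFinM; congr (_ * _)%E.
have e0 : 0 < 1 + scale_ratio theta * z.
  by rewrite addr_gt0// mulr_gt0// divr_gt0.
have l0 : 0 < s^-1 + z / t by rewrite addr_gt0 ?divr_gt0 ?invr_gt0.
rewrite -integral_loss_gamma ?divr_gt0 ?phi0//.
apply: eq_integral => y _; rewrite /K /L0 /phi' /= z0.
have -> : y / (s^-1 + z / t) * phi z / s
    = phi z / (1 + scale_ratio theta * z) * y; last by [].
(* The rate 1 / s + z / t, multiplied by s, depends on the scales through eta = s / t only. *)
have -> : 1 + scale_ratio theta * z = s * (s^-1 + z / t).
  by rewrite /scale_ratio mulrDr divff ?gt_eqF// -/s -/t; ring.
by rewrite invfM; ring.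
Qed.

(** * Domination by the truncated estimator *)

Theorem theorem2p1 (R : realType) (a1 b1 n1 a2 b2 n2 : nat)
    (a1_ge1 : (1 <= a1)%N) (a1_lt_b1 : (a1 < b1)%N) (b1_le_n1 : (b1 <= n1)%N)
    (a2_ge1 : (1 <= a2)%N) (a2_lt_b2 : (a2 < b2)%N) (b2_le_n2 : (b2 <= n2)%N)
    (d : measure_display) (Omega : measurableType d)
    (P : param R -> probability Omega R)
    (Xa1 Xa2 V1 V2 : {mfun Omega >-> R})
    (model : censored_model a1 b1 n1 a2 b2 n2 P Xa1 Xa2 V1 V2)
    (L : R -> R) (L_bowl : bowl_shaped_loss L)
    (L_regular : loss_regular ((b1 + b2) - (a1 + a2)) L)
    (phi : R -> R)
    (phi_measurable : measurable_fun (`]0, +oo[ : set R) phi)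
    (phi_gt0 : forall z : R, 0 < z -> 0 < phi z)
    (risk_finite : forall theta,
      (risk P L theta (scale_estimator V1 V2 phi) < +oo)%E)
    (beta : R)
    (beta_unique : unique
      (fun u : R => 0 < u /\
        gamma_mean ((b1 + b2) - (a1 + a2)).+1 (fun z => derive1 L (u * z)) = 0)
      beta)
    (phi_exceeds : exists2 eta : R, 0 < eta &
      exists2 theta : param R, scale_ratio theta = eta &
        P theta [set w | beta * (1 + V2 w / V1 w) < phi (V2 w / V1 w)] <> 0%E) :
  let phi_star := fun z => Num.min (phi z) (beta * (1 + z)) in
  forall theta : param R,
    (risk P L theta (scale_estimator V1 V2 phi_star)
     < risk P L theta (scale_estimator V1 V2 phi))%E.
Proof.
move=> phi_star theta.
have k0 : (0 < b1 - a1 + (b2 - a2))%N by rewrite addn_gt0 subn_gt0 a1_lt_b1.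
(* Subtraction on [nat] truncates at 0, so this regrouping relies on a1 < b1 and a2 < b2. *)
have kE : ((b1 + b2) - (a1 + a2) = b1 - a1 + (b2 - a2))%N.
  by rewrite addnBA 1?ltnW// addnC subnDA addnC -addnBAC// ltnW.
rewrite kE in L_regular beta_unique.
have incr := gamma_mean_loss_incr L_bowl L_regular k0 beta_unique.
have beta0 : 0 < beta by case: beta_unique => -[].
pose D : set R := `]0, +oo[%classic.
have inD z : D z <-> 0 < z by rewrite /D /= in_itv/= andbT.
have mline : measurable_fun D (fun z => beta * (1 + z)).
  by apply: measurable_funM => //; exact: measurable_funD.
have mphi_star : measurable_fun D phi_star by exact: measurable_minr.
have phi_star_gt0 (z : R) : 0 < z -> 0 < phi_star z.
  by move=> z0; rewrite /phi_star lt_min phi_gt0//= mulr_gt0// addr_gt0.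
pose B := D `&` [set z | beta * (1 + z) < phi z].
have mD : measurable D by exact: measurable_itv.
have mB : measurable B by exact: (measurable_fun_ltr mline phi_measurable mD).
(* If B were null, the event in [phi_exceeds] would have probability 0 under [theta0]. The
   conclusion is free of the parameter, so it serves for every [theta]. *)
have B_gt0 : lebesgue_measure B != 0%E.
  case: phi_exceeds => _ _ [theta0 _ PB]; apply/eqP => B0; apply: PB.
  have t0 := lt_le_trans (sigma1_gt0 theta0) (sigma1_le2 theta0).
  rewrite -(gamma_ratio_null _ _ (sigma1_gt0 theta0) t0 (law_V1 model theta0)
    (law_V2 model theta0) (independent_V1_V2 theta0 model) mB B0) ?subn_gt0//.
  congr (P theta0 _); apply/seteqP; split => w /=; last by case.
  split=> //; apply/inD.
  by rewrite divr_gt0 ?(V1_gt0 model) ?(V2_gt0 model).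
set eta := scale_ratio theta.
have s0 := sigma1_gt0 theta.
have t0 := lt_le_trans s0 (sigma1_le2 theta).
have eta0 : 0 < eta by rewrite divr_gt0.
have eta1 : eta <= 1 by rewrite ler_pdivrMr// mul1r sigma1_le2.
have e0 (z : R) : 0 < z -> 0 < 1 + eta * z.
  by move=> z0; rewrite addr_gt0// mulr_gt0.
have w0 (z : R) : 0 < z -> 0 < gamma_ratio_pdf (b1 - a1) (b2 - a2)
    (sigma1 theta) (sigma2 theta) z.
  exact: gamma_ratio_pdf_gt0.
pose g c := gamma_mean (b1 - a1 + (b2 - a2)) (fun y => L (c * y)).
have g_ge0 (c : R) : 0 < c -> 0 <= g c.
  move=> c0; apply: Rintegral_ge0 => y /=; rewrite in_itv/= andbT => y0.
  by rewrite mulr_ge0 ?gamma_pdf_ge0// bowl_loss_ge0// mulr_gt0.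
have mg : measurable_fun D g.
  by apply: derivable_pos_measurable => c /(loss_derive_mean L_regular)[].
have mrisk (psi : R -> R) : measurable_fun D psi -> (forall z, 0 < z -> 0 < psi z) ->
    measurable_fun D (fun z => gamma_ratio_pdf (b1 - a1) (b2 - a2)
      (sigma1 theta) (sigma2 theta) z * g (psi z / (1 + eta * z))).
  move=> mpsi psi0; apply: measurable_funM.
    by apply: measurable_funTS; exact: measurable_gamma_ratio_pdf.
  apply: (measurable_comp mD _ mg).
    by move=> _ [z /inD z0 <-]; apply/inD; rewrite divr_gt0 ?psi0 ?e0.
  apply: measurable_funM => //; apply: measurable_funTS.
  apply: (measurableT_comp (@measurable_invr R)).
  by apply: measurable_funD => //; exact: measurable_funM.
(* On B the smaller argument is beta (1 + z) / (1 + eta z), at least [beta] because eta <= 1; [incr]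
   therefore applies. *)
have star_lt z : B z -> g (phi_star z / (1 + eta * z)) < g (phi z / (1 + eta * z)).
  move=> [/inD z0 /= ltphi]; apply: incr.
    rewrite /phi_star (min_r (ltW ltphi)) ler_pdivlMr ?e0// ler_pM2l// lerD2l.
    by rewrite ler_piMl// ltW.
  by rewrite ltr_pM2r ?invr_gt0 ?e0// /phi_star (min_r (ltW ltphi)).
have riskE := risk_scale_estimatorE theta a1_lt_b1 a2_lt_b2 model L_bowl L_regular.
rewrite !riskE//; apply: (@ge0_integral_lt _ _ _ lebesgue_measure D B) => //.
- by move=> z [].
- exact: mrisk.
- exact: mrisk.
- move=> z /inD z0; apply/andP; split.
    rewrite mulr_ge0 ?g_ge0 ?divr_gt0 ?phi_star_gt0 ?e0//.
    exact/ltW/w0.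
  rewrite ler_pM2l ?w0//.
  have [phi_le|phi_gt] := leP (phi z) (beta * (1 + z)).
    by rewrite /phi_star min_l.
  by apply/ltW/star_lt; split=> //; apply/inD.
- move=> z Bz; rewrite ltr_pM2l; first exact: star_lt.
  by apply: w0; apply/inD; case: Bz.
(* Finite risk of the original estimator is what allows a strict inequality. *)
- by rewrite -riskE.
Qed.
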